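(* Let $(P_n)_n$ be the monic matrix orthogonal polynomials of a weight $W$, with square norms $\mathcal H_n$, and let $(Q_x)_x$ be a dual sequence with corresponding $\rho$, so that $P_n(x)=P_n(0)Q_x(\rho(n))\Upsilon(x)$ for all $x,n\in\mathbb N_0$. Consider the matrix weight $U(n)=P_n(0)^*\mathcal H_n^{-1}P_n(0)$. Assume that $$\sum_{n=0}^\infty F(n)U(n)<\infty$$ (i.e. the series converges) for any matrix valued function $F$ with rational entries and no poles in $\mathbb N_0$, and that $$\lim_{n\to\infty}R_1(\rho(n))\,P_n(0)\,\mathcal H_n^{-1}\,P_{n+1}(0)^*\,R_2(\rho(n))=0\qquad\text{for all }R_1,R_2\in M_N(\mathbb C)[n].$$ Then the dual sequence $(Q_x)_x$ satisfies the orthogonality relation $$\langle Q_x,Q_y\rangle^d=\sum_{n=0}^\infty Q_x(\rho(n))^*U(n)Q_y(\rho(n))=\mathscr W_x\,\delta_{x,y},$$ where $\mathscr W_x\in M_N(\mathbb C)$.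
   Context: $\mathbb N_0=\{0,1,2,\dots\}$; $N\ge1$ is fixed; $I$ is the identity of $M_N(\mathbb C)$. A weight is a function $W:\mathbb Z\to M_N(\mathbb C)$ with $W(x)$ positive definite for $x\in\mathbb N_0$, $W(x)=0$ for $x<0$, and finite moments of all orders. With $\langle P,Q\rangle=\sum_{x=0}^\infty P(x)W(x)Q(x)^*$, $(P_n)_n$ is the unique sequence of monic matrix polynomials with $\deg P_n=n$ and $\langle P_m,P_n\rangle=\mathcal H_m\delta_{m,n}$, $\mathcal H_m$ positive definite. $M_N(\mathbb C)[n]$ denotes the $N\times N$ matrix polynomials. Matrix polynomials in a matrix variable $\mathcal N$ are evaluated with the variable on the left: $Q(\mathcal N)=\sum_k\mathcal N^kA_k$. A dual sequence: monic matrix polynomials $(Q_x)_{x\in\mathbb N_0}$, $\deg Q_x=x$, together with a function $\rho:\mathbb N_0\to M_N(\mathbb C)$ and an invertible matrix valued function $\Upsilon$ on $\mathbb N_0$ with $\Upsilon(0)=I$ and $\Upsilon(x+1)^{-1}\Upsilon(x)$ rational in $x$, such that: $P_n(0)$ is invertible for all $n\in\mathbb N_0$; $P_n(x)=P_n(0)Q_x(\rho(n))\Upsilon(x)$ for all $x,n\in\mathbb N_0$; there are matrices $\mathcal Y_x,\mathcal Z_x$ with $\rho(n)Q_x(\rho(n))=Q_{x+1}(\rho(n))+Q_x(\rho(n))\mathcal Y_x+Q_{x-1}(\rho(n))\mathcal Z_x$ for all $x,n\in\mathbb N_0$, $Q_0=I$, $Q_{-1}=0$, $\mathcal Z_0=0$;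 and $\rho$ satisfies: each entry of $\rho(n)$ is a rational function of $n$ without poles in $\mathbb N_0$, and for every $x\in\mathbb N_0$ there exist $k_0,\dots,k_x\in\mathbb N_0$ such that the block Vandermonde matrix with $(i,j)$ block $\rho(k_i)^j$, $0\le i,j\le x$, is invertible. *)

(* Defs.v *)
From HB Require Import structures.
From mathcomp Require Export all_boot all_order all_algebra complex.
From mathcomp Require Export sesquilinear spectral.
From mathcomp Require Export all_classical all_reals all_analysis.

Set Implicit Arguments.
Unset Strict Implicit.
Unset Printing Implicit Defensive.

Export Order.TTheory GRing.Theory Num.Theory.
Export numFieldNormedType.Exports.

Local Open Scope classical_set_scope.
Local Open Scope ring_scope.
Local Open Scope complex_scope.
Local Open Scope sesquilinear_scope.

Section Definitions.
Variables (R : realType) (N : nat).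

(* 'M[C]_n is a nontrivial ring, hence has polynomials over it, only for n of
   the form N.+1; so matrices of size N >= 1 are written with size N.+1. *)
Local Notation C := R[i].
Local Notation M := 'M[C]_N.+1.

Implicit Types (u f F rho Ups H : nat -> M) (W : int -> M).
Implicit Types (P Q : nat -> {poly M}).

(* The topology of C is carried by the alias C^o = C. *)
Definition mxcvg u (l : M) : Prop :=
  (u : nat -> 'M[C^o]_N.+1) @ \oo --> (l : 'M[C^o]_N.+1).

Definition mxsum f (S : M) : Prop :=
  mxcvg (fun n => \sum_(0 <= k < n) f k) S.

Definition mxsummable f : Prop := exists S : M, mxsum f S.

Definition posdefmx (A : M) : Prop :=
  A \is hermsymmx /\
  forall v : 'cV[C]_N.+1, v != 0 -> 0 < (v ^t* *m A *m v) 0 0.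

(* Entries that are rational functions of the variable, without poles in
   {0, 1, 2, ...}. *)
Definition rational_mx F : Prop :=
  forall i j, exists p q : {poly C}, forall n : nat,
    q.[n%:R] != 0 /\ F n i j = p.[n%:R] / q.[n%:R].

(* Evaluation with the variable on the left of the coefficients (library
   evaluation q.[A] has it on the right). *)
Definition lhorner (q : {poly M}) (A : M) : M :=
  \sum_(k < size q) A ^+ k * q`_k.

Record weight W : Prop := {
  weight_posdef : forall x : nat, posdefmx (W x%:Z);
  weight_neg : forall x : int, x < 0 -> W x = 0;
  weight_moments : forall k : nat,
    mxsummable (fun x => (x%:R : C) ^+ k *: W x%:Z) }.

(* [inner W p q S] : the series defining <p, q> converges, with sum S; the
   argument x%:R is the scalar matrix x I. *)
Definition inner W (p q : {poly M}) (S : M) : Prop :=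
  mxsum (fun x => p.[x%:R] * W x%:Z * (q.[x%:R]) ^t*) S.

Record monic_orthogonal W P H : Prop := {
  orth_monic : forall n, P n \is monic;
  orth_size : forall n, size (P n) = n.+1;
  orth_norm : forall n, posdefmx (H n);
  orth_inner : forall m n, inner W (P m) (P n) (H m *+ (m == n)) }.

(* Q_(x-1), with Q_(-1) = 0. *)
Definition prevQ Q (x : nat) : {poly M} := if x is x'.+1 then Q x' else 0.

Record dual_sequence P Q rho Ups : Prop := {
  dual_P0_unit : forall n, (P n).[0] \is a GRing.unit;
  dual_monic : forall x, Q x \is monic;
  dual_size : forall x, size (Q x) = x.+1;
  dual_Ups_unit : forall x, Ups x \is a GRing.unit;
  dual_Ups0 : Ups 0%N = 1;
  dual_Ups_rational : rational_mx (fun x => (Ups x.+1)^-1 * Ups x);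
  dual_duality : forall x n : nat,
    (P n).[x%:R] = (P n).[0] * lhorner (Q x) (rho n) * Ups x;
  dual_Q0 : Q 0%N = 1;
  dual_recurrence : exists Y Z : nat -> M, Z 0%N = 0 /\
    forall x n : nat,
      rho n * lhorner (Q x) (rho n) =
        lhorner (Q x.+1) (rho n) + lhorner (Q x) (rho n) * Y x
        + lhorner (prevQ Q x) (rho n) * Z x;
  dual_rho_rational : rational_mx rho;
  dual_rho_vandermonde : forall x : nat, exists k : 'I_x.+1 -> nat,
    \mxblock_(i < x.+1, j < x.+1) (rho (k i) ^+ j) \in unitmx }.

Definition dual_weight P H (n : nat) : M :=
  ((P n).[0]) ^t* * (H n)^-1 * (P n).[0].

(* [dual_inner P H rho q1 q2 S] : the series defining <q1, q2>^d converges,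
   with sum S. *)
Definition dual_inner P H rho (q1 q2 : {poly M}) (S : M) : Prop :=
  mxsum (fun n => (lhorner q1 (rho n)) ^t* * dual_weight P H n
                    * lhorner q2 (rho n)) S.

End Definitions.

(* Main.v *)
Require Import Defs.

(** The normalized polynomials [p_n(x) = P_n(0)^-1 P_n(x) = Q_x(rho(n)) Ups(x)]
    carry the duality: up to the factors [Ups], the dual inner product of [Q_y]
    and [Q_x] is the limit of the Christoffel-Darboux kernels
    [sum_(k < n) P_k(y)^* H_k^-1 P_k(x)] at the points [x] and [y].

    Its existence follows from the summability of the dual weight [U]: since the
    entries of [Q_x(rho(n))] are rational in [n], they can be moved, as scalars,
    to the left of [U] ([summable_sandwich]).

    For [x != y] the Christoffel-Darboux formula ([christoffel_darboux]) writes
    [x - y] times the kernel as a boundary term minus the adjoint of its mirror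
    image, the boundary term being
    [p_n(y)^* U(n) D_n p_(n+1)(x)] with [D_n = P_n(0)^-1 P_(n+1)(0)]. The weight
    [U(n)] decays faster than any power of [n], because the series of [n^k U(n)]
    converges, and [p_n(y)], [p_(n+1)(x)] are rational in [n]. So the boundary
    term vanishes at infinity as soon as [D_n] has polynomial growth.

    This growth comes from the three-term recurrence. Normalized at [x = 0] it
    reads
    [D_n (p_(n+1)(x) - p_n(x)) + E_n (p_(n-1)(x) - p_n(x)) = x p_n(x)].
    At [x = 1] and [x = 2] it is a linear system for the row [(D_n, E_n)] whose
    coefficients are rational in [n]. Its determinant is a rational function of
    [n], and it does not vanish at [n = 1] because [p_0], [p_1], [p_2] have
    degrees 0, 1, 2 with invertible leading coefficients
    ([initial_block_unit]). Hence it vanishes only finitely often, and Cramer's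
    rule bounds [D_n] by a power of [n] ([slow_ratio0]). *)

Set Implicit Arguments.
Unset Strict Implicit.
Unset Printing Implicit Defensive.

(** * Entrywise convergence of complex matrices *)

Section Convergence.
Local Open Scope classical_set_scope.
Local Open Scope ring_scope.
Local Open Scope complex_scope.
Local Open Scope sesquilinear_scope.
Variables (R : realType) (N : nat).
Local Notation C := R[i].
Local Notation M := 'M[C]_N.+1.
Implicit Types (t : nat -> C) (u v : nat -> M).

Definition ccvg t (l : C) : Prop := (t : nat -> C^o) @ \oo --> (l : C^o).

Lemma mxcvgP u (l : M) :
  mxcvg u l <-> forall i j, ccvg (fun n => u n i j) (l i j).
Proof.
split=> [ul i j | ul].
  exact: (@cvg_comp _ _ _ (u : nat -> 'M[C^o]_N.+1)
            (fun A : 'M[C^o]_N.+1 => A i j) _ _ _ ul (@coord_continuous C^o _ _ i j l)).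
move=> A [B Bl BA].
have : \forall n \near \oo, forall i j, B i j (u n i j).
  by apply: filter_forall => i; apply: filter_forall => j; apply: ul; exact: Bl.
by apply: filterS => n Bn; exact: BA.
Qed.

Lemma ccvgD t s a b : ccvg t a -> ccvg s b -> ccvg (fun n => t n + s n) (a + b).
Proof. exact: (@cvgD C^o C^o). Qed.

Lemma ccvgM t s a b : ccvg t a -> ccvg s b -> ccvg (fun n => t n * s n) (a * b).
Proof. exact: (@cvgM C^o). Qed.

Lemma ccvg_cst (a : C) : ccvg (fun=> a) a.
Proof. exact: (@cvg_cst C^o). Qed.

Lemma ccvg_sum (I : Type) (r : seq I) (F : I -> nat -> C) (a : I -> C) :
  (forall i, ccvg (F i) (a i)) ->
  ccvg (fun n => \sum_(i <- r) F i n) (\sum_(i <- r) a i).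
Proof.
move=> Fa; elim: r => [|i r IHr].
  by rewrite big_nil; under eq_fun do rewrite big_nil; exact: ccvg_cst.
by rewrite big_cons; under eq_fun do rewrite big_cons; exact: ccvgD.
Qed.

Lemma ccvg_unique t a b : ccvg t a -> ccvg t b -> a = b.
Proof. by move=> ta tb; apply: (cvg_unique _ ta tb); exact: (@norm_hausdorff C^o C^o). Qed.

Lemma ccvg_conj t a : ccvg t a -> ccvg (fun n => (t n)^*%R) (a^*)%R.
Proof.
move=> /(@cvgrPdist_lt C^o C^o) ta; apply/(@cvgrPdist_lt C^o C^o) => e /ta.
by apply: filterS => n; rewrite -rmorphB norm_conjC.
Qed.

Lemma ccvgS t a : ccvg t a -> ccvg (fun n => t n.+1) a.
Proof. by move=> ta; rewrite /ccvg (@cvg_shiftS C^o). Qed.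

Lemma ccvg0_le t s :
  (exists m, forall n, (m <= n)%N -> `|t n| <= `|s n|) -> ccvg s 0 -> ccvg t 0.
Proof.
move=> [m ts] /(@cvgr0Pnorm_lt C^o C^o) s0; apply/(@cvgr0Pnorm_lt C^o C^o) => e /s0 se.
near=> n; apply: le_lt_trans (ts n _) _; first by near: n; exact: nbhs_infty_ge.
by near: n.
Unshelve. all: by end_near. Qed.

Lemma mxcvg_ext u v l : (forall n, u n = v n) -> mxcvg u l -> mxcvg v l.
Proof. by move=> uv; rewrite (_ : u = v) //; apply: funext. Qed.

Lemma mxcvgD u v a b : mxcvg u a -> mxcvg v b -> mxcvg (fun n => u n + v n) (a + b).
Proof.
move=> /mxcvgP ua /mxcvgP vb; apply/mxcvgP => i j; rewrite mxE.
by under eq_fun do rewrite mxE; exact: ccvgD.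
Qed.

Lemma mxcvgM u v a b : mxcvg u a -> mxcvg v b -> mxcvg (fun n => u n * v n) (a * b).
Proof.
move=> /mxcvgP ua /mxcvgP vb; apply/mxcvgP => i j; rewrite mxE.
by under eq_fun do rewrite mxE; apply: ccvg_sum => k; exact: ccvgM.
Qed.

Lemma mxcvg_cst (a : M) : mxcvg (fun=> a) a.
Proof. exact: cvg_cst. Qed.

Lemma mxcvgN u a : mxcvg u a -> mxcvg (fun n => - u n) (- a).
Proof.
move=> ua; rewrite -mulN1r; apply: (mxcvg_ext _ (mxcvgM (@mxcvg_cst (-1)) ua)) => n.
by rewrite mulN1r.
Qed.

Lemma mxcvg_unique u a b : mxcvg u a -> mxcvg u b -> a = b.
Proof.
move=> /mxcvgP ua /mxcvgP ub; apply/matrixP => i j.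
exact: ccvg_unique (ua i j) (ub i j).
Qed.

Lemma mxcvgS u a : mxcvg u a -> mxcvg (fun n => u n.+1) a.
Proof. by move=> /mxcvgP ua; apply/mxcvgP => i j; exact: ccvgS (ua i j). Qed.

Lemma mxcvg_trC u a : mxcvg u a -> mxcvg (fun n => (u n) ^t*) (a ^t*).
Proof.
move=> /mxcvgP ua; apply/mxcvgP => i j; rewrite !mxE.
by under eq_fun do rewrite !mxE; exact: ccvg_conj.
Qed.

Lemma mxsum_cvg0 u S : mxsum u S -> mxcvg u 0.
Proof.
move=> uS; rewrite -(subrr S).
apply: (mxcvg_ext _ (mxcvgD (mxcvgS uS) (mxcvgN uS))) => n.
by rewrite big_nat_recr //= addrAC subrr add0r.
Qed.

End Convergence.

Local Open Scope ring_scope.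
Local Open Scope complex_scope.
Local Open Scope sesquilinear_scope.

(** * Rational sequences and polynomial growth *)

Section RationalSequences.
Variable R : realType.
Local Notation C := R[i].
Implicit Types (t s : nat -> C).

(** The condition that [rational_mx] imposes on each entry, and to which it
    unfolds. *)
Definition ratseq t : Prop := exists p q : {poly C}, forall n : nat,
  q.[n%:R] != 0 /\ t n = p.[n%:R] / q.[n%:R].

Lemma ratseq_horner (p : {poly C}) : ratseq (fun n => p.[n%:R]).
Proof. by exists p, 1 => n; rewrite !hornerE oner_neq0 divr1. Qed.

Lemma ratseq_cst (a : C) : ratseq (fun=> a).
Proof. by exists a%:P, 1 => n; rewrite !hornerE oner_neq0 divr1. Qed.

Lemma ratseqD t s : ratseq t -> ratseq s -> ratseq (fun n => t n + s n).
Proof.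
move=> [p [q pq]] [p' [q' pq']]; exists (p * q' + p' * q), (q * q') => n.
have [[q0 ->] [q'0 ->]] := (pq n, pq' n).
by rewrite hornerD !hornerM; split; [exact: mulf_neq0 | rewrite addf_div].
Qed.

Lemma ratseqM t s : ratseq t -> ratseq s -> ratseq (fun n => t n * s n).
Proof.
move=> [p [q pq]] [p' [q' pq']]; exists (p * p'), (q * q') => n.
have [[q0 ->] [q'0 ->]] := (pq n, pq' n).
by rewrite !hornerM; split; [exact: mulf_neq0 | rewrite mulf_div].
Qed.

Lemma ratseq_sum (I : Type) (r : seq I) (F : I -> nat -> C) :
  (forall i, ratseq (F i)) -> ratseq (fun n => \sum_(i <- r) F i n).
Proof.
move=> rF; elim: r => [|i r IHr].
  by under eq_fun do rewrite big_nil; exact: ratseq_cst.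
by under eq_fun do rewrite big_cons; exact: ratseqD.
Qed.

Lemma ratseq_prod (I : Type) (r : seq I) (F : I -> nat -> C) :
  (forall i, ratseq (F i)) -> ratseq (fun n => \prod_(i <- r) F i n).
Proof.
move=> rF; elim: r => [|i r IHr].
  by under eq_fun do rewrite big_nil; exact: ratseq_cst.
by under eq_fun do rewrite big_cons; exact: ratseqM.
Qed.

Lemma ratseq_conj t : ratseq t -> ratseq (fun n => (t n)^*%R).
Proof.
move=> [p [q pq]]; exists (map_poly Num.conj p), (map_poly Num.conj q) => n.
have conj_horner f : (map_poly Num.conj f).[n%:R : C] = (f.[n%:R])^*%R.
  by rewrite -[in LHS](rmorph_nat Num.conj n) horner_map.
have [q0 ->] := pq n.
by rewrite !conj_horner fmorph_eq0 fmorph_div.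
Qed.

Lemma ratseqS t : ratseq t -> ratseq (fun n => t n.+1).
Proof.
move=> [p [q pq]]; exists (p \Po ('X + 1)), (q \Po ('X + 1)) => n.
by rewrite !horner_comp !hornerD !hornerX !hornerC natr1; exact: pq.
Qed.

Lemma ratseq_det m (F : nat -> 'M[C]_m) :
  (forall i j, ratseq (fun n => F n i j)) -> ratseq (fun n => \det (F n)).
Proof.
move=> rF; apply: ratseq_sum => s; apply: ratseqM; first exact: ratseq_cst.
by apply: ratseq_prod => i.
Qed.

Lemma ratseq_adj m (F : nat -> 'M[C]_m) i j :
  (forall i j, ratseq (fun n => F n i j)) -> ratseq (fun n => (\adj (F n)) i j).
Proof.
move=> rF; under eq_fun do rewrite mxE.
apply: ratseqM; first exact: ratseq_cst.
by apply: ratseq_det => k l; under eq_fun do rewrite !mxE.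
Qed.

(** Polynomial growth. Constants are absorbed by an extra power of [n], so no
    multiplicative constant appears. *)
Definition slow t : Prop :=
  exists k m, forall n, (m <= n)%N -> `|t n| <= n%:R ^+ k.

Lemma normC_le_nat (c : C) : exists b : nat, `|c| <= b%:R.
Proof.
case: c => x y; rewrite normc_def /=; set r := Num.sqrt _.
exists (Num.bound r); rewrite -(rmorph_nat (@real_complex R)) lecR ltW //.
by rewrite archi_boundP // sqrtr_ge0.
Qed.

Lemma slow_le t (c : C) k m :
  (forall n, (m <= n)%N -> `|t n| <= c * n%:R ^+ k) -> slow t.
Proof.
move=> tc; have [b cb] := normC_le_nat c.
exists k.+1, (maxn m b) => n; rewrite geq_max => /andP[mn bn].
have n0 : (0 : C) <= n%:R ^+ k by rewrite exprn_ge0.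
have cn0 : 0 <= c * n%:R ^+ k := le_trans (normr_ge0 (t n)) (tc n mn).
apply: le_trans (tc n mn) _.
rewrite -(ger0_norm cn0) normrM (ger0_norm n0) exprS ler_wpM2r //.
by apply: le_trans cb _; rewrite ler_nat.
Qed.

Lemma slowD t s : slow t -> slow s -> slow (fun n => t n + s n).
Proof.
move=> [k [m tk]] [k' [m' sk]].
apply: (@slow_le _ 2 (maxn k k') (maxn 1 (maxn m m'))) => n.
rewrite !geq_max => /and3P[n1 mn mn'].
apply: le_trans (ler_normD _ _) _; rewrite mulr_natl mulr2n.
have n1' : (1 : C) <= n%:R by rewrite ler1n.
apply: lerD; [apply: le_trans (tk n mn) _ | apply: le_trans (sk n mn') _].
  by rewrite ler_weXn2l // leq_maxl.
by rewrite ler_weXn2l // leq_maxr.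
Qed.

Lemma slowM t s : slow t -> slow s -> slow (fun n => t n * s n).
Proof.
move=> [k [m tk]] [k' [m' sk]]; exists (k + k')%N, (maxn m m') => n.
rewrite geq_max => /andP[mn mn'].
by rewrite normrM exprD ler_pM //; [exact: tk | exact: sk].
Qed.

Lemma slow_cst (a : C) : slow (fun=> a).
Proof. by apply: (@slow_le _ `|a| 0 0) => n _; rewrite expr0 mulr1. Qed.

Lemma slow_conj t : slow t -> slow (fun n => (t n)^*%R).
Proof. by move=> [k [m tk]]; exists k, m => n mn; rewrite norm_conjC tk. Qed.

Lemma slow_sum (I : Type) (r : seq I) (F : I -> nat -> C) :
  (forall i, slow (F i)) -> slow (fun n => \sum_(i <- r) F i n).
Proof.
move=> rF; elim: r => [|i r IHr].
  by under eq_fun do rewrite big_nil; exact: slow_cst.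
by under eq_fun do rewrite big_cons; exact: slowD.
Qed.

Lemma slow_eventually_eq t s :
  (exists m, forall n, (m <= n)%N -> t n = s n) -> slow s -> slow t.
Proof.
move=> [m ts] [k [m' sk]]; exists k, (maxn m m') => n.
by rewrite geq_max => /andP[mn mn']; rewrite ts // sk.
Qed.

Lemma slow_horner (p : {poly C}) : slow (fun n => p.[n%:R]).
Proof.
under eq_fun do rewrite horner_coef.
apply: slow_sum => i; apply: slowM; first exact: slow_cst.
by exists (i : nat), 0%N => n _; rewrite normrX normr_nat.
Qed.

(** Each factor of the factorization of [p] over the algebraically closed
    field C is eventually at least 1 in modulus. *)
Lemma horner_eventually_ge (p : {poly C}) : p != 0 ->
  exists m, forall n, (m <= n)%N -> `|lead_coef p| <= `|p.[n%:R]|.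
Proof.
move=> p0; have [r {2}->] := closed_field_poly_normal p.
have [m rm] : exists m, forall n, (m <= n)%N ->
    1 <= `|(\prod_(z <- r) ('X - z%:P)).[n%:R]|.
  elim: r => [|z r [m IHr]]; first by exists 0%N => n _; rewrite big_nil hornerE normr1.
  have [b zb] := normC_le_nat z.
  exists (maxn m b.+1) => n; rewrite geq_max => /andP[mn bn].
  rewrite big_cons hornerM normrM hornerXsubC.
  have nz : 1 <= `|n%:R - z|.
    apply: le_trans (lerB_dist _ _); rewrite normr_nat lerBrDr.
    by apply: le_trans (lerD (lexx 1) zb) _; rewrite nat1r ler_nat.
  by apply: mulr_ege1; [exact: nz | exact: IHr].
exists m => n mn; rewrite hornerZ normrM ler_peMr //; exact: rm.
Qed.

(** A single nonvanishing value makes the numerator a nonzero polynomial, hence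
    eventually bounded away from 0. This is what turns invertibility of a
    rational matrix at one index into control of its inverse at infinity. *)
Lemma ratseq_eventually_inv t (n0 : nat) : ratseq t -> t n0 != 0 ->
  exists m, (forall n, (m <= n)%N -> t n != 0) /\ slow (fun n => (t n)^-1).
Proof.
move=> [p [q pq]] tn0.
have p0 : p != 0.
  by apply: contraNneq tn0 => p0; have [_ ->] := pq n0; rewrite p0 horner0 mul0r.
have lp : 0 < `|lead_coef p| by rewrite normr_gt0 lead_coef_eq0.
have [m pm] := horner_eventually_ge p0.
have pn n : (m <= n)%N -> p.[n%:R] != 0.
  by move=> /pm/(lt_le_trans lp); rewrite normr_gt0.
exists m; split=> [n mn|].
  by have [q0 ->] := pq n; rewrite mulf_neq0 ?invr_eq0 // pn.
have -> : (fun n => (t n)^-1) = (fun n => (p.[n%:R])^-1 * q.[n%:R]).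
  by apply: funext => n; have [_ ->] := pq n; rewrite invf_div mulrC.
apply: slowM (slow_horner q); apply: (@slow_le _ `|lead_coef p|^-1 0 m) => n mn.
by rewrite expr0 mulr1 normfV lef_pV2 ?pm // posrE normr_gt0 pn.
Qed.

Lemma ratseq_slow t : ratseq t -> slow t.
Proof.
move=> [p [q pq]].
have rq : ratseq (fun n => q.[n%:R]) by exact: ratseq_horner.
have [_ [_ sq]] := ratseq_eventually_inv rq (pq 0%N).1.
have -> : t = (fun n => p.[n%:R] * (q.[n%:R])^-1).
  by apply: funext => n; have [_ ->] := pq n.
exact: slowM (slow_horner p) sq.
Qed.

Lemma slow_unshift t : slow (fun n => t n.+1) -> slow t.
Proof.
move=> [k [m tk]]; exists k, m.+1 => -[//|n] mn.
by apply: le_trans (tk n mn) _; rewrite lerXn2r ?nnegrE // ler_nat.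
Qed.

End RationalSequences.

(** * Rational matrix functions and rapidly decaying weights *)

Section RationalMatrices.
Variables (R : realType) (N : nat).
Local Notation C := R[i].
Local Notation M := 'M[C]_N.+1.
Implicit Types (F G A B U : nat -> M).

Lemma rational_mx_cst (a : M) : rational_mx (fun=> a).
Proof. by move=> i j; exact: ratseq_cst. Qed.

Lemma rational_mxD F G :
  rational_mx F -> rational_mx G -> rational_mx (fun n => F n + G n).
Proof.
move=> rF rG i j; change (ratseq (fun n => (F n + G n) i j)).
by under eq_fun do rewrite mxE; exact: ratseqD.
Qed.

Lemma rational_mxM F G :
  rational_mx F -> rational_mx G -> rational_mx (fun n => F n * G n).
Proof.
move=> rF rG i j; change (ratseq (fun n => (F n * G n) i j)).
by under eq_fun do rewrite mxE; apply: ratseq_sum => k; exact: ratseqM.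
Qed.

Lemma rational_mxN F : rational_mx F -> rational_mx (fun n => - F n).
Proof.
move=> rF; have := rational_mxM (rational_mx_cst (-1)) rF.
by under eq_fun do rewrite mulN1r.
Qed.

Lemma rational_mxB F G :
  rational_mx F -> rational_mx G -> rational_mx (fun n => F n - G n).
Proof. by move=> rF rG; exact: (rational_mxD rF (rational_mxN rG)). Qed.

Lemma rational_mxX F k : rational_mx F -> rational_mx (fun n => F n ^+ k).
Proof.
move=> rF; elim: k => [|k IHk]; first exact: rational_mx_cst.
by under eq_fun do rewrite exprS; exact: rational_mxM.
Qed.

Lemma rational_mx_sum (I : Type) (r : seq I) (F : I -> nat -> M) :
  (forall i, rational_mx (F i)) -> rational_mx (fun n => \sum_(i <- r) F i n).
Proof.
move=> rF; elim: r => [|i r IHr].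
  by under eq_fun do rewrite big_nil; exact: rational_mx_cst.
by under eq_fun do rewrite big_cons; exact: rational_mxD.
Qed.

Lemma rational_mx_lhorner (q : {poly M}) F :
  rational_mx F -> rational_mx (fun n => lhorner q (F n)).
Proof.
move=> rF; apply: rational_mx_sum => k.
by apply: rational_mxM (rational_mx_cst _); exact: rational_mxX.
Qed.

Lemma rational_mx_trC F : rational_mx F -> rational_mx (fun n => (F n) ^t*).
Proof.
move=> rF i j; change (ratseq (fun n => ((F n) ^t*) i j)).
by under eq_fun do rewrite !mxE; exact: ratseq_conj.
Qed.

Lemma rational_mxS F : rational_mx F -> rational_mx (fun n => F n.+1).
Proof. by move=> rF i j; exact: (ratseqS (rF i j)). Qed.

Lemma rational_mxZ t F :
  ratseq t -> rational_mx F -> rational_mx (fun n => t n *: F n).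
Proof.
move=> rt rF i j; change (ratseq (fun n => (t n *: F n) i j)).
by under eq_fun do rewrite mxE; exact: ratseqM.
Qed.

Definition slow_mx F : Prop := forall i j, slow (fun n => F n i j).

Lemma rational_slow_mx F : rational_mx F -> slow_mx F.
Proof. by move=> rF i j; exact: (ratseq_slow (rF i j)). Qed.

Lemma slow_mxM F G : slow_mx F -> slow_mx G -> slow_mx (fun n => F n * G n).
Proof.
move=> sF sG i j; under eq_fun do rewrite mxE.
by apply: slow_sum => k; exact: slowM.
Qed.

Lemma slow_mx_trC F : slow_mx F -> slow_mx (fun n => (F n) ^t*).
Proof. by move=> sF i j; under eq_fun do rewrite !mxE; exact: slow_conj. Qed.

(** Cramer's rule: the determinant of the system is a rational function of [n],
    not identically zero because of [n0], so for all but finitely many [n] the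
    entries of [X n] are values of rational functions. At the finitely many
    zeros of the determinant the equations leave [X n] undetermined, which is
    why the conclusion is growth and not rationality. *)
Lemma slow_solution (a a' b b' c c' X Y : nat -> M) (n0 : nat) :
  rational_mx a -> rational_mx a' -> rational_mx b -> rational_mx b' ->
  rational_mx c -> rational_mx c' ->
  (forall n, X n * a n + Y n * b n = c n) ->
  (forall n, X n * a' n + Y n * b' n = c' n) ->
  block_mx (a n0) (a' n0) (b n0) (b' n0) \in unitmx ->
  slow_mx X.
Proof.
move=> ra ra' rb rb' rc rc' XYc XYc' unit0.
pose B n := block_mx (a n) (a' n) (b n) (b' n).
have rB i j : ratseq (fun n => B n i j).
  rewrite /B; case: (split_ordP i) => k ->; case: (split_ordP j) => l ->.
  - by under eq_fun do rewrite block_mxEul; exact: ra.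
  - by under eq_fun do rewrite block_mxEur; exact: ra'.
  - by under eq_fun do rewrite block_mxEdl; exact: rb.
  - by under eq_fun do rewrite block_mxEdr; exact: rb'.
have rc2 i j : ratseq (fun n => row_mx (c n) (c' n) i j).
  case: (split_ordP j) => l ->.
  - by under eq_fun do rewrite row_mxEl; exact: rc.
  - by under eq_fun do rewrite row_mxEr; exact: rc'.
have rdet := ratseq_det rB.
have det0 : \det (B n0) != 0 by rewrite -unitfE -unitmxE.
have [m [detm sdet]] := ratseq_eventually_inv rdet det0.
have cramer n : \det (B n) *: row_mx (X n) (Y n) = row_mx (c n) (c' n) *m \adj (B n).
  rewrite -mul_mx_scalar -mul_mx_adj mulmxA /B mul_row_block.
  by rewrite -(XYc n) -(XYc' n).
move=> i j.
apply: (@slow_eventually_eq _ _ (fun n => (\det (B n))^-1 *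
    \sum_k row_mx (c n) (c' n) i k * (\adj (B n)) k (lshift _ j))).
  exists m => n mn; apply: (canRL (mulKf (detm n mn))).
  have /matrixP/(_ i (lshift _ j)) := cramer n.
  by rewrite [LHS]mxE row_mxEl [RHS]mxE.
apply: slowM sdet _; apply: slow_sum => k; apply: slowM.
  by apply: ratseq_slow; exact: rc2.
by apply: ratseq_slow; exact: ratseq_adj.
Qed.

Section RapidDecay.
Variable U : nat -> M.
Hypothesis hU : forall F, rational_mx F -> mxsummable (fun n => F n * U n).

Lemma mxsum_sum (I : Type) (r : seq I) (F : I -> nat -> M) :
  (forall i, mxsummable (F i)) -> mxsummable (fun n => \sum_(i <- r) F i n).
Proof.
move=> sF; elim: r => [|i r [S rS]].
  exists 0; apply: (mxcvg_ext _ (@mxcvg_cst _ _ 0)) => n.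
  by rewrite big1 // => k _; rewrite big_nil.
have [T iT] := sF i; exists (T + S); apply: (mxcvg_ext _ (mxcvgD iT rS)) => n.
by rewrite -big_split /=; apply: eq_bigr => k _; rewrite big_cons.
Qed.

Lemma mxsumMr F S (a : M) : mxsum F S -> mxsum (fun n => F n * a) (S * a).
Proof.
move=> FS; apply: (mxcvg_ext _ (mxcvgM FS (@mxcvg_cst _ _ a))) => n.
by rewrite mulr_suml.
Qed.

(** The entries of [G] are scalars, so they can be carried over to the left of
    [U]: on the matrix units, [F U G] is a finite combination of terms
    [(G_kl F) U] multiplied by constants, to which the hypothesis on left
    factors applies. *)
Lemma summable_sandwich F G : rational_mx F -> rational_mx G ->
  mxsummable (fun n => F n * U n * G n).
Proof.
move=> rF rG.
have -> : (fun n => F n * U n * G n) = fun n => \sum_k \sum_l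
    (G n k l *: F n) * U n * delta_mx k l.
  apply: funext => n; rewrite {1}(matrix_sum_delta (G n)) mulr_sumr.
  apply: eq_bigr => k _; rewrite mulr_sumr; apply: eq_bigr => l _.
  by rewrite -!scalerAl -scalerAr.
apply: mxsum_sum => k; apply: mxsum_sum => l.
have [|S FS] := @hU (fun n => G n k l *: F n); first exact: rational_mxZ.
by exists (S * delta_mx k l); exact: mxsumMr.
Qed.

(** The terms of the convergent series of [n^k U(n)] tend to 0 for every [k], so
    [U] decays faster than any power of [n]. *)
Lemma slow_sandwich_cvg0 A B : slow_mx A -> slow_mx B ->
  mxcvg (fun n => A n * U n * B n) 0.
Proof.
move=> sA sB.
have Ut t i j : slow t -> ccvg (fun n => t n * U n i j) 0.
  move=> [k [m tk]].
  have [S US] : mxsummable (fun n => ((n%:R : C) ^+ k *: 1) * U n).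
    apply: hU; apply: rational_mxZ (rational_mx_cst 1).
    by exists 'X^k, 1 => n; rewrite !hornerE oner_neq0 divr1.
  have /mxcvgP/(_ i j) := mxsum_cvg0 US; rewrite mxE; apply: ccvg0_le.
  exists m => n mn; rewrite -scalerAl mul1r mxE !normrM ler_wpM2r //.
  by rewrite normrX normr_nat tk.
apply/mxcvgP => i j; rewrite mxE.
have E : (fun n => (A n * U n * B n) i j) =
    fun n => \sum_k \sum_l (A n i l * B n k j) * U n l k.
  apply: funext => n; rewrite mxE; apply: eq_bigr => k _.
  by rewrite mxE mulr_suml; apply: eq_bigr => l _; rewrite mulrAC.
have sum0 : (0 : C) = \sum_(k < N.+1) 0 by rewrite big1.
rewrite E [X in ccvg _ X]sum0.
apply: (@ccvg_sum _ _ _ _ (fun=> 0)) => k; rewrite [X in ccvg _ X]sum0.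
apply: (@ccvg_sum _ _ _ _ (fun=> 0)) => l.
by apply: Ut; exact: slowM.
Qed.

End RapidDecay.
End RationalMatrices.

(** * Identities in noncommutative rings *)

(** The Christoffel-Darboux telescoping, as an identity in a noncommutative
    ring. The sequence [b] stands for the adjoints of the second family: it
    satisfies the mirrored recurrence, with the coefficients on the right. *)
Lemma christoffel_darboux_recurrence (A : unitRingType) (a b h B B' : nat -> A)
    (x y : A) :
  (forall n, h n \is a GRing.unit) ->
  (forall n, (h n)^-1 * B n = B' n / h n) ->
  a 0 * x = a 1 + B 0 * a 0 ->
  (forall n, a n.+1 * x = a n.+2 + B n.+1 * a n.+1 + h n.+1 / h n * a n) ->
  y * b 0 = b 1 + b 0 * B' 0 ->
  (forall n, y * b n.+1 =
     b n.+2 + b n.+1 * B' n.+1 + b n * ((h n)^-1 * h n.+1)) ->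
  forall n, \sum_(0 <= k < n.+1)
      (b k / h k * (a k * x) - (y * b k) / h k * a k) =
    b n / h n * a n.+1 - b n.+1 / h n * a n.
Proof.
move=> uh hB a0 aS b0 bS; elim=> [|n IHn].
  rewrite big_nat1 a0 b0 mulrDr !mulrDl -[b 0 * B' 0 / h 0]mulrA -hB !mulrA.
  by rewrite opprD addrACA subrr addr0.
rewrite big_nat_recr //= IHn aS bS !mulrDr !mulrDl.
rewrite -[b n.+1 * B' n.+1 / h n.+1]mulrA -hB !mulrA.
(* The last two terms of the recurrences at [n.+1] are the boundary terms at [n],
   with the roles of [a] and [b] exchanged. *)
rewrite mulrVK // mulrK //.
rewrite [X in _ + (X - _)]addrC addrA addrA subrK [X in _ - X]addrC.
by rewrite opprD addrACA subrr add0r opprD addrACA subrr addr0.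
Qed.

Lemma difference_form (A : pzRingType) (d e u v w : A) :
  d * u + (- d - e) * v + e * w = d * (u - v) + e * (w - v).
Proof.
by rewrite mulrDl !mulNr !mulrBr [e * w - _]addrC !addrA.
Qed.

Lemma insert_unit (A : unitRingType) (a s h u v b : A) : u \is a GRing.unit ->
  a * (s * h * u) * (u^-1 * v * b) = a * s * h * (v * b).
Proof. by move=> uu; rewrite !mulrA mulrK. Qed.

(** * Adjoints and positive definite matrices *)

Section Adjoints.
Variables (R : realType) (N : nat).
Local Notation M := 'M[R[i]]_N.+1.

Lemma trCM (A B : M) : (A * B) ^t* = B ^t* * A ^t*.
Proof. by rewrite -[A * B]/(A *m B) trmx_mul map_mxM. Qed.

Lemma trC1 : (1 : M) ^t* = 1.
Proof. by rewrite trmx1 map_mx1. Qed.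

Lemma trC0 : (0 : M) ^t* = 0.
Proof. by rewrite trmx0 map_mx0. Qed.

Lemma trCD (A B : M) : (A + B) ^t* = A ^t* + B ^t*.
Proof. by rewrite linearD /= map_mxD. Qed.

Lemma trC_nat n : (n%:R : M) ^t* = n%:R.
Proof. by elim: n => [|n IHn]; rewrite ?trC0 // -natr1 trCD IHn trC1. Qed.

Lemma trC_unit (A : M) : (A ^t* \is a GRing.unit) = (A \is a GRing.unit).
Proof. by rewrite -[LHS]/(A ^t* \in unitmx) map_unitmx unitmx_tr. Qed.

Lemma trCV (A : M) : A \is a GRing.unit -> (A^-1) ^t* = (A ^t*)^-1.
Proof.
move=> uA; have uA' : A ^t* \is a GRing.unit by rewrite trC_unit.
by apply: (mulrI uA'); rewrite divrr // -trCM mulVr // trC1.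
Qed.

Lemma posdefmx_trC (A : M) : posdefmx A -> A ^t* = A.
Proof. by case=> /is_hermitianmxP; rewrite expr0 scale1r. Qed.

Lemma posdefmx_unit (A : M) : posdefmx A -> A \is a GRing.unit.
Proof.
case=> _ A_gt0; change (A \in unitmx); rewrite -unitmx_tr -row_free_unit.
apply: inj_row_free => v vA0; apply/eqP/negPn/negP => v0.
have /A_gt0 : v^T != 0 by rewrite trmx_eq0.
by rewrite -mulmxA -[A]trmxK -trmx_mul vA0 trmx0 mulmx0 mxE ltxx.
Qed.

End Adjoints.

(** * Three-term recurrence and Christoffel-Darboux formula *)

Section ThreeTerm.
Variables (R : realType) (N : nat).
Local Notation C := R[i].
Local Notation M := 'M[C]_N.+1.

Variables (W : int -> M) (P : nat -> {poly M}) (H : nat -> M).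
Hypotheses (hW : weight W) (hP : monic_orthogonal W P H).
Implicit Types (p q : {poly M}) (S : M).

Lemma innerD p p' q S S' :
  inner W p q S -> inner W p' q S' -> inner W (p + p') q (S + S').
Proof.
move=> pS pS'; apply: (mxcvg_ext _ (mxcvgD pS pS')) => n.
by rewrite -big_split; apply: eq_bigr => k _; rewrite hornerD !mulrDl.
Qed.

Lemma innerZ A p q S : inner W p q S -> inner W (A%:P * p) q (A * S).
Proof.
move=> pS; apply: (mxcvg_ext _ (mxcvgM (@mxcvg_cst _ _ A) pS)) => n.
by rewrite mulr_sumr; apply: eq_bigr => k _; rewrite hornerCM !mulrA.
Qed.

Lemma inner0 q : inner W 0 q 0.
Proof.
apply: (mxcvg_ext _ (@mxcvg_cst _ _ 0)) => n.
by rewrite big1 // => k _; rewrite horner0 !mul0r.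
Qed.

Lemma inner_sum (r : seq nat) (F : nat -> {poly M}) (a : nat -> M) q :
  (forall k, inner W (F k) q (a k)) ->
  inner W (\sum_(k <- r) F k) q (\sum_(k <- r) a k).
Proof.
move=> Fa; elim: r => [|k r IHr]; first by rewrite !big_nil; exact: inner0.
by rewrite !big_cons; exact: (innerD (Fa k) IHr).
Qed.

Lemma inner_trC p q S : inner W p q S -> inner W q p (S ^t*).
Proof.
move=> pS; apply: (mxcvg_ext _ (mxcvg_trC pS)) => n.
elim: n => [|n IHn]; first by rewrite !big_geq // trC0.
rewrite !big_nat_recr //= trCD IHn; congr (_ + _).
by rewrite !trCM trmxCK (posdefmx_trC (weight_posdef hW n)) mulrA.
Qed.

(** Multiplication by the variable is symmetric for the inner product, because
    the points [x] of the support are real scalars. *)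
Lemma inner_mulX p q S : inner W (p * 'X) q S <-> inner W p (q * 'X) S.
Proof.
have E n : \sum_(0 <= x < n) (p * 'X).[x%:R] * W x%:Z * (q.[x%:R]) ^t* =
    \sum_(0 <= x < n) p.[x%:R] * W x%:Z * ((q * 'X).[x%:R]) ^t*.
  apply: eq_bigr => x _; rewrite !hornerMX trCM trC_nat !mulrA; congr (_ * _).
  by rewrite -!mulrA; congr (_ * _); rewrite mulr_natl mulr_natr.
by split=> pS; refine (mxcvg_ext _ pS) => n; rewrite E.
Qed.

Lemma inner_unique p q S S' : inner W p q S -> inner W p q S' -> S = S'.
Proof. exact: mxcvg_unique. Qed.

(** The [P k] are monic with one polynomial in each degree; the leading
    coefficient of [p] is removed by subtracting a left multiple of [P m]. *)
Lemma orth_expansion m p : (size p <= m)%N ->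
  exists A : nat -> M, p = \sum_(0 <= k < m) (A k)%:P * P k.
Proof.
elim: m p => [|m IHm] p sp.
  by exists (fun=> 0); rewrite big_geq //; apply/eqP; rewrite -size_poly_leq0.
have [|A pA] := IHm (p - (p`_m)%:P * P m).
  apply/leq_sizeP => j mj; rewrite coefB coefCM.
  case: (ltngtP j m) mj => // [mj _|-> _].
    have Pj : (P m)`_j = 0 by rewrite nth_default // (orth_size hP).
    by rewrite (nth_default _ (leq_trans sp mj)) Pj mulr0 subrr.
  have := monicP (orth_monic hP m).
  by rewrite lead_coefE (orth_size hP) /= => ->; rewrite mulr1 subrr.
exists (fun k => if k == m then p`_m else A k).
rewrite big_nat_recr //= eqxx -[LHS](subrK ((p`_m)%:P * P m)) pA; congr (_ + _).
by apply: eq_big_nat => k /andP[_ km]; rewrite ltn_eqF.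
Qed.

Lemma inner_expansion m (A : nat -> M) k :
  inner W (\sum_(0 <= j < m) (A j)%:P * P j) (P k) (A k * H k *+ (k < m)).
Proof.
have -> : A k * H k *+ (k < m) = \sum_(0 <= j < m) A j * (H j *+ (j == k)).
  case: ltnP => km; last first.
    rewrite big_nat big1 // => j /andP[_ jm].
    by rewrite ltn_eqF ?mulr0 //; exact: leq_trans jm km.
  rewrite big_mkord (bigD1 (Ordinal km)) //= eqxx big1 ?addr0 // => j.
  by rewrite -val_eqE /= => /negPf->; rewrite mulr0.
by apply: inner_sum => j; apply: innerZ; exact: orth_inner hP j k.
Qed.

(** [T n k] are the coefficients of multiplication by the variable in the basis
    [P]; the last item is the symmetry of that operator. *)
Lemma jacobi_matrix : exists T : nat -> nat -> M,
  [/\ forall n, P n * 'X = \sum_(0 <= k < n.+2) (T n k)%:P * P k,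
      forall n, T n n.+1 = 1,
      forall n k, (n.+1 < k)%N -> T n k = 0 &
      forall n k, T n k * H k = H n * (T k n) ^t*].
Proof.
have ex n : exists A : nat -> M, P n * 'X - P n.+1 = \sum_(0 <= k < n.+1) (A k)%:P * P k.
  apply: orth_expansion; apply/leq_sizeP => j nj; rewrite coefB coefMX.
  case: j nj => // j; rewrite ltnS /= => nj; case: (ltngtP j n) nj => // [nj _|-> _].
    by rewrite !nth_default ?subrr // (orth_size hP).
  have := monicP (orth_monic hP n); have := monicP (orth_monic hP n.+1).
  by rewrite !lead_coefE !(orth_size hP) /= => -> ->; rewrite subrr.
have [A AP] := choice ex.
pose T n k := if k == n.+1 then 1 else if (k <= n)%N then A n k else 0.
have TP n : P n * 'X = \sum_(0 <= k < n.+2) (T n k)%:P * P k.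
  rewrite big_nat_recr //= -[LHS](subrK (P n.+1)) AP {2}/T eqxx mul1r.
  congr (_ + _); apply: eq_big_nat => k /andP[_]; rewrite ltnS => kn.
  by rewrite /T kn ltn_eqF.
have T0 n k : (n.+1 < k)%N -> T n k = 0.
  by move=> nk; rewrite /T gtn_eqF // leqNgt (ltnW nk).
have TH n k : inner W (P n * 'X) (P k) (T n k * H k).
  have := @inner_expansion n.+2 (T n) k; rewrite -TP.
  case: ltnP => kn; first by rewrite mulr1n.
  by rewrite (T0 n k kn) mul0r mul0rn.
exists T; split=> // [n|n k]; first by rewrite /T eqxx.
apply: inner_unique (TH n k) _; apply/inner_mulX.
have := inner_trC (TH k n).
by rewrite trCM (posdefmx_trC (orth_norm hP n)).
Qed.

(** The Jacobi matrix vanishes above the first superdiagonal by degree, and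
    therefore below the first subdiagonal by symmetry. *)
Lemma three_term : exists B : nat -> M,
  [/\ forall n, B n * H n = H n * (B n) ^t*,
      P 0 * 'X = P 1 + (B 0)%:P * P 0 &
      forall n, P n.+1 * 'X =
        P n.+2 + (B n.+1)%:P * P n.+1 + (H n.+1 / H n)%:P * P n].
Proof.
have [T [TP T1 T0 TH]] := jacobi_matrix.
have uH n : H n \is a GRing.unit := posdefmx_unit (orth_norm hP n).
have Tlow n k : (k.+1 < n)%N -> T n k = 0.
  by move=> kn; apply: (mulIr (uH k)); rewrite TH T0 // trC0 mulr0 mul0r.
exists (fun n => T n n); split=> [n||n]; first exact: TH.
  by rewrite TP !big_nat_recr //= big_geq // add0r T1 mul1r addrC.
rewrite TP !big_nat_recr //= big_nat big1 => [|k /andP[_ kn]]; last first.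
  by rewrite Tlow // mul0r.
rewrite add0r T1 mul1r addrC [X in _ + X]addrC addrA; congr (_ + _%:P * _).
by apply: (mulIr (uH n)); rewrite TH T1 trC1 mulr1 divrK.
Qed.

(** The middle coefficients cancel because [B n H n] is hermitian. *)
Lemma christoffel_darboux (x y n : nat) :
  \sum_(0 <= k < n.+1) ((P k).[y%:R]) ^t* / H k * (P k).[x%:R] * (x%:R - y%:R) =
  ((P n).[y%:R]) ^t* / H n * (P n.+1).[x%:R]
  - ((P n.+1).[y%:R]) ^t* / H n * (P n).[x%:R].
Proof.
have [B [BH B0 BS]] := three_term.
have uH m : H m \is a GRing.unit := posdefmx_unit (orth_norm hP m).
have HH m : (H m) ^t* = H m := posdefmx_trC (orth_norm hP m).
have recX p (z : nat) : (p * 'X).[z%:R] = p.[z%:R] * z%:R :> M by rewrite hornerMX.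
have HB m : (H m)^-1 * B m = (B m) ^t* / H m.
  by apply: (mulrI (uH m)); apply: (mulIr (uH m)); rewrite mulVKr // mulrA divrK.
rewrite -(@christoffel_darboux_recurrence _ (fun k => (P k).[x%:R])
  (fun k => ((P k).[y%:R]) ^t*) H B (fun k => (B k) ^t*) x%:R y%:R) //.
- apply: eq_bigr => k _; rewrite mulrBr !mulrA; congr (_ - _).
  by rewrite mulr_natr -!mulrA mulr_natl.
- by rewrite -recX B0 hornerD hornerCM.
- by move=> m; rewrite -recX BS !hornerD !hornerCM.
- by rewrite -{1}(trC_nat R N y) -trCM -recX B0 hornerD hornerCM trCD trCM.
- move=> m; rewrite -{1}(trC_nat R N y) -trCM -recX BS !hornerD !hornerCM !trCD.
  by congr (_ + _ + _); rewrite trCM // trCM (trCV (uH m)) !HH.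
Qed.

End ThreeTerm.

(** * The difference equation in the degree *)

Section NormalizedPolynomials.
Variables (R : realType) (N : nat).
Local Notation C := R[i].
Local Notation M := 'M[C]_N.+1.
Variables (W : int -> M) (P : nat -> {poly M}) (H : nat -> M).
Hypotheses (hW : weight W) (hP : monic_orthogonal W P H).
Hypothesis P0_unit : forall n, (P n).[0] \is a GRing.unit.

(** [P n] scaled to take the value 1 at 0. By duality this is
    [Q_x(rho(n)) Ups(x)], a rational function of [n] for fixed [x]. *)
Definition normalized (n x : nat) : M := ((P n).[0])^-1 * (P n).[x%:R].

(** The matrix of the linear system for the coefficients of the difference
    equation at the points 1 and 2. The rows come from polynomials in [x] of
    degrees 2 and 1 vanishing at 0: subtracting twice the first block column
    from the second leaves only twice the leading coefficient of
    [normalized 2] in the first row and 0 in the second. *)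
Lemma initial_block_unit :
  block_mx (normalized 2 1 - normalized 1 1) (normalized 2 2 - normalized 1 2)
           (normalized 0 1 - normalized 1 1) (normalized 0 2 - normalized 1 2)
    \in unitmx.
Proof.
have coefP k n : (P n)`_k = if k == n then 1 else (P n)`_k.
  case: eqP => // ->; have := monicP (orth_monic hP n).
  by rewrite lead_coefE (orth_size hP).
have evalP n (x : nat) : (P n).[x%:R] = \sum_(i < n.+1) (P n)`_i * x%:R ^+ i.
  by rewrite horner_coef (orth_size hP).
have eval0 n : (P n).[0] = (P n)`_0 := horner_coef0 (P n).
pose g n : M := ((P n)`_0)^-1.
have ug n : g n \is a GRing.unit by rewrite unitrV -eval0.
have gP n : g n * (P n)`_0 = 1 by rewrite mulVr // -eval0.
have n0 x : normalized 0 x = 1.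
  by rewrite /normalized evalP eval0 big_ord1 mulr1 gP.
have n1 x : normalized 1 x = 1 + g 1 *+ x.
  rewrite /normalized evalP eval0 2!big_ord_recr big_ord0 /= add0r.
  by rewrite mulr1 mulrDr gP (coefP 1 1) eqxx expr1 mul1r mulr_natr.
have n2 x : normalized 2 x = 1 + (g 2 * (P 2)`_1) *+ x + g 2 *+ (x ^ 2).
  rewrite /normalized evalP eval0 3!big_ord_recr big_ord0 /= add0r.
  rewrite mulr1 !mulrDr gP (coefP 2 2) eqxx expr1 mul1r mulr_natr.
  by rewrite mulrnAr -natrX mulr_natr.
(* The linear terms double from [x = 1] to [x = 2], the quadratic one is
   multiplied by 4. *)
set a := normalized 2 1 - _; set b := normalized 0 1 - _.
have bE : b = - g 1 by rewrite /b n0 n1 opprD addNKr.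
have b2 : normalized 0 2 - normalized 1 2 = (2 : C) *: b.
  by rewrite scaler_nat bE n0 n1 opprD addNKr mulNrn.
have a2 : normalized 2 2 - normalized 1 2 = (2 : C) *: (a + g 2).
  have arith (c d e : M) :
      1 + c *+ 2 + d *+ 4 - (1 + e *+ 2) = (1 + c + d - (1 + e) + d) *+ 2.
    have shift (c' d' e' : M) : 1 + c' + d' - (1 + e') = c' + d' - e'.
      by rewrite -(addrA 1 c' d') opprD addrACA subrr add0r.
    rewrite !shift !mulrnDl mulNrn [in RHS]addrAC -(addrA _ (d *+ 2) (d *+ 2)).
    by rewrite -mulrnDr.
  by rewrite scaler_nat /a !n1 !n2 arith.
rewrite a2 b2 -row_free_unit; apply: inj_row_free => v.
rewrite -[v]hsubmxK mul_row_block.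
set v1 := lsubmx v; set v2 := rsubmx v.
rewrite -[X in _ = X]row_mx0 => /eq_row_mx[e1 e2].
have g_inj n (w : 'rV[C]_N.+1) : w *m g n = 0 -> w = 0.
  by move=> wg; rewrite -[w]mulmx1 -(mulmxV (ug n)) mulmxA wg mul0mx.
have two0 : (2 : C) != 0 by rewrite pnatr_eq0.
have v10 : v1 = 0.
  apply: (g_inj 2); apply: (scalerI two0).
  move: e2; rewrite -!scalemxAr mulmxDr scalerDr addrAC -scalerDr e1.
  by rewrite !scaler0 add0r.
have v20 : v2 = 0.
  apply: (g_inj 1); apply: oppr_inj; rewrite -mulmxN -bE oppr0.
  by move: e1; rewrite v10 mul0mx add0r.
by rewrite v10 v20 row_mx0.
Qed.

(** The three-term recurrence divided by [P_(n+1)(0)]; its value at [x = 0],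
    where the normalized polynomials are 1, eliminates the middle
    coefficient. *)
Lemma normalized_difference_equation :
  exists E : nat -> M, forall n x,
    ((P n.+1).[0])^-1 * (P n.+2).[0] * (normalized n.+2 x - normalized n.+1 x)
      + E n * (normalized n x - normalized n.+1 x)
    = normalized n.+1 x * x%:R.
Proof.
have [B [_ _ BS]] := three_term hW hP.
pose g n : M := ((P n).[0])^-1.
pose F n := g n.+1 * B n.+1 * (P n.+1).[0].
pose E n := g n.+1 * (H n.+1 / H n) * (P n).[0].
pose D n := g n.+1 * (P n.+2).[0].
have rec n (x : nat) : normalized n.+1 x * x%:R =
    D n * normalized n.+2 x + F n * normalized n.+1 x + E n * normalized n x.
  rewrite /normalized -mulrA -hornerMX BS !hornerD !hornerCM !mulrDr.
  by rewrite /D /F /E !mulrA !mulrK // -!mulrA !mulKr.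
have n0 n : normalized n 0 = 1 by rewrite /normalized mulVr.
have DFE n : F n = - D n - E n.
  have := rec n 0; rewrite !n0 !mulr1 mulr0n mulr0 => /esym/eqP.
  by rewrite addrAC addrC addr_eq0 => /eqP->; rewrite opprD.
by exists E => n x; rewrite rec DFE difference_form.
Qed.

End NormalizedPolynomials.

(** * The boundary term and dual orthogonality *)

Section Boundary.
Variables (R : realType) (N : nat).
Local Notation C := R[i].
Local Notation M := 'M[C]_N.+1.
Variables (W : int -> M) (P : nat -> {poly M}) (H : nat -> M).
Variables (Q : nat -> {poly M}) (rho Ups : nat -> M).
Hypotheses (hW : weight W) (hP : monic_orthogonal W P H).
Hypothesis hQ : dual_sequence P Q rho Ups.

Lemma normalized_dual n x : normalized P n x = lhorner (Q x) (rho n) * Ups x.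
Proof.
rewrite /normalized (dual_duality hQ) -mulrA mulKr //.
exact: dual_P0_unit hQ n.
Qed.

Lemma rational_normalized x : rational_mx (fun n => normalized P n x).
Proof.
under eq_fun do rewrite normalized_dual.
apply: rational_mxM (rational_mx_cst _).
by apply: rational_mx_lhorner; exact: dual_rho_rational hQ.
Qed.

(** Coefficient of the top term of the difference equation; it is
    the factor of the boundary term whose growth has to be derived from the
    recurrence. *)
Definition ratio0 (n : nat) : M := ((P n).[0])^-1 * (P n.+1).[0].

(** The difference equation at [x = 1, 2] is a linear system with rational
    coefficients for its two unknown coefficients, nonsingular at [n = 0]. *)
Lemma slow_ratio0 : slow_mx ratio0.
Proof.
have [E DE] := normalized_difference_equation hW hP (dual_P0_unit hQ).
have rS x := rational_mxS (rational_normalized x).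
have rSS x := rational_mxS (rS x).
have r12 x := rational_mxB (rSS x) (rS x).
have r10 x := rational_mxB (rational_normalized x) (rS x).
have rx x := rational_mxM (rS x) (@rational_mx_cst R N x%:R).
have sS : slow_mx (fun n => ratio0 n.+1).
  exact: (slow_solution (r12 1%N) (r12 2%N) (r10 1%N) (r10 2%N) (rx 1%N) (rx 2%N)
    (fun n => DE n 1%N) (fun n => DE n 2%N)
    (initial_block_unit hP (dual_P0_unit hQ))).
by move=> i j; exact: slow_unshift (sS i j).
Qed.

Hypothesis hU : forall F : nat -> M, rational_mx F ->
  mxsummable (fun n => F n * dual_weight P H n).

Lemma evalE n x : (P n).[x%:R] = (P n).[0] * normalized P n x.
Proof. by rewrite /normalized mulVKr //; exact: (dual_P0_unit hQ n). Qed.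

Lemma kernel_term x y n :
  ((P n).[y%:R]) ^t* / H n * (P n).[x%:R] =
  (normalized P n y) ^t* * dual_weight P H n * normalized P n x.
Proof.
by rewrite (evalE n y) (evalE n x) trCM /dual_weight !mulrA.
Qed.

Lemma boundary_term x y n :
  ((P n).[y%:R]) ^t* / H n * (P n.+1).[x%:R] =
  (normalized P n y) ^t* * dual_weight P H n * (ratio0 n * normalized P n.+1 x).
Proof.
rewrite (evalE n.+1 x) (evalE n y) trCM /dual_weight /ratio0.
by rewrite insert_unit //; exact: (dual_P0_unit hQ n).
Qed.

(** The dual weight decays faster than any power of [n], and the factors on both
    sides of it grow at most polynomially. *)
Lemma boundary_cvg0 x y :
  mxcvg (fun n => ((P n).[y%:R]) ^t* / H n * (P n.+1).[x%:R]) 0.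
Proof.
under eq_fun do rewrite boundary_term.
apply: (slow_sandwich_cvg0 hU).
  by apply: slow_mx_trC; apply: rational_slow_mx; exact: rational_normalized.
apply: slow_mxM slow_ratio0 _; apply: rational_slow_mx.
exact: rational_mxS (rational_normalized x).
Qed.

Lemma christoffel_darboux_cvg0 x y :
  mxcvg (fun n => \sum_(0 <= k < n)
    ((P k).[y%:R]) ^t* / H k * (P k).[x%:R] * (x%:R - y%:R)) 0.
Proof.
have HH n : (H n) ^t* = H n := posdefmx_trC (orth_norm hP n).
have uH n : H n \is a GRing.unit := posdefmx_unit (orth_norm hP n).
have cd : mxcvg (fun n => \sum_(0 <= k < n.+1)
    ((P k).[y%:R]) ^t* / H k * (P k).[x%:R] * (x%:R - y%:R)) 0.
  have := mxcvgD (boundary_cvg0 x y) (mxcvgN (mxcvg_trC (boundary_cvg0 y x))).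
  rewrite trC0 subrr; apply: mxcvg_ext => n.
  rewrite (christoffel_darboux hW hP) !trCM trmxCK (trCV (uH n)) HH.
  by rewrite !mulrA.
apply/mxcvgP => i j; have /mxcvgP/(_ i j) := cd.
by rewrite /ccvg (@cvg_shiftS R[i]^o (fun n => (\sum_(0 <= k < n)
    ((P k).[y%:R]) ^t* / H k * (P k).[x%:R] * (x%:R - y%:R)) i j)).
Qed.

Lemma mulrn_mx_inj (A : M) m n : m != n -> A *+ m = A *+ n -> A = 0.
Proof.
move=> mn Amn; apply/matrixP => i j; rewrite [RHS]mxE; apply/eqP/negPn/negP => Aij.
have /matrixP/(_ i j) := Amn; rewrite !mulmxnE => /(mulrIn Aij) eq_mn.
by rewrite eq_mn eqxx in mn.
Qed.

(** The limit of the Christoffel-Darboux identity is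
    [(x - y) Ups(y)^* S Ups(x) = 0]. *)
Lemma dual_orthogonality x y S : x != y ->
  dual_inner P H rho (Q y) (Q x) S -> S = 0.
Proof.
move=> xy QS.
have uU z := dual_Ups_unit hQ z.
have uU' : (Ups y) ^t* \is a GRing.unit.
  by rewrite trC_unit.
set T := (Ups y) ^t* * S * Ups x.
have KT : mxcvg (fun n => \sum_(0 <= k < n)
    ((P k).[y%:R]) ^t* / H k * (P k).[x%:R] * (x%:R - y%:R)) (T * (x%:R - y%:R)).
  have := mxcvgM (mxcvgM (mxcvgM (@mxcvg_cst R N ((Ups y) ^t*)) QS)
    (@mxcvg_cst R N (Ups x))) (@mxcvg_cst R N (x%:R - y%:R)).
  apply: mxcvg_ext => n.
  rewrite mulr_sumr !mulr_suml; apply: eq_bigr => k _.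
  by rewrite kernel_term !normalized_dual trCM !mulrA.
have := mxcvg_unique KT (christoffel_darboux_cvg0 x y).
rewrite mulrBr !mulr_natr => /eqP; rewrite subr_eq0 => /eqP Txy.
have T0 : T = 0 := mulrn_mx_inj xy Txy.
by apply: (mulrI uU'); apply: (mulIr (uU x)); rewrite -/T T0 mulr0 mul0r.
Qed.

End Boundary.

Theorem theorem3p14 (R : realType) (N : nat)
    (W : int -> 'M[R[i]]_N.+1)
    (P : nat -> {poly 'M[R[i]]_N.+1}) (H : nat -> 'M[R[i]]_N.+1)
    (Q : nat -> {poly 'M[R[i]]_N.+1})
    (rho Ups : nat -> 'M[R[i]]_N.+1)
    (hW : weight W)
    (hP : monic_orthogonal W P H)
    (hQ : dual_sequence P Q rho Ups)
    (hU : forall F : nat -> 'M[R[i]]_N.+1, rational_mx F ->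
       mxsummable (fun n => F n * dual_weight P H n))
    (hlim : forall R1 R2 : {poly 'M[R[i]]_N.+1},
       mxcvg (fun n => lhorner R1 (rho n) * (P n).[0] * (H n)^-1
                         * ((P n.+1).[0]) ^t* * lhorner R2 (rho n)) 0) :
  exists Wd : nat -> 'M[R[i]]_N.+1,
    forall x y : nat, dual_inner P H rho (Q x) (Q y) (Wd x *+ (x == y)).
Proof.
have rQ x : rational_mx (fun n => lhorner (Q x) (rho n)).
  by apply: rational_mx_lhorner; exact: dual_rho_rational hQ.
have sum_exists x y : exists S, dual_inner P H rho (Q x) (Q y) S.
  exact: (summable_sandwich hU (rational_mx_trC (rQ x)) (rQ y)).
have [Wd WdP] := choice (fun x => sum_exists x x).
exists Wd => x y; have [<-|xy] := eqVneq x y; first by rewrite mulr1n; exact: WdP.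
have [S QS] := sum_exists x y; rewrite mulr0n.
by rewrite -(dual_orthogonality hW hP hQ hU _ QS) // eq_sym.
Qed.
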